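(* There is an absolute constant $C>0$ such that the following holds. Let $\mathbb{F}_q$ be a finite field ($q$ an arbitrary prime power) and let $A\subset \mathbb{F}_q$. If $|(A+A)\cap (aG+b)|\le |G|^{1/2}$ for every subfield $G$ of $\mathbb{F}_q$, every $a\in\mathbb{F}_q^*$ and every $b\in\mathbb{F}_q$, then $$\max\{|A+A|,\ |A^2+A^2|\}\ge C\,|A|^{1+\frac{1}{42}}.$$
   Context: For $X,Y\subset\mathbb{F}_q$: $X+Y=\{x+y: x\in X,\,y\in Y\}$ and $X^2=\{x^2: x\in X\}$ (the set of squares of elements of $X$, not the product set). For a subfield $G$, $aG+b=\{ag+b: g\in G\}$. $\mathbb{F}_q^*=\mathbb{F}_q\setminus\{0\}$. The subfields $G$ include $\mathbb{F}_q$ itself. The constant $C$ does not depend on $q$ or $A$. *)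

(* Defs.v *)
From HB Require Import structures.
From mathcomp Require Import all_boot all_order all_algebra.

Set Implicit Arguments.
Unset Strict Implicit.
Unset Printing Implicit Defensive.

Import GRing.Theory.
Local Open Scope ring_scope.

Section FiniteFieldSets.

Variable F : finFieldType.

Definition sumset (X Y : {set F}) : {set F} := [set x + y | x in X, y in Y].

(* The set of squares of the elements of X, not the product set X X. *)
Definition square_set (X : {set F}) : {set F} := [set x ^+ 2 | x in X].

Definition affine_image (a b : F) (G : {set F}) : {set F} :=
  [set a * g + b | g in G].

Definition is_subfield (G : {set F}) : Prop := divring_closed G.

End FiniteFieldSets.

(* Main.v *)
(** Let [N = #|A|], [B = square_set A], and suppose [A + A] and [B + B] have at most [K N]
    elements. Call [s] popular if the set [A_s] of the [p] in [A] with [s - p] in [A] has at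
    least [N / 2K] elements. From [s (2p - s) = p^2 - (s - p)^2] the dilate [s A_s] lies in a
    translate of [(B - B) / 2], so by the Ruzsa and Pluennecke inequalities a sum of [n] sets
    [+/- s_i A] with all [s_i] popular has at most [(8 K^4)^n N] elements.

    For some [b] in [A], the set [X] of popular elements of [A + b] has at least [N / 2]
    elements. Let [Q = (X - X) / (X - X)]. If [Q] is not closed under products or under
    [r |-> r + 1], some [xi] outside [Q] of that shape makes [X + xi X] of size [#|X|^2].
    Otherwise [Q] is a subfield and [X] lies in an affine image of [Q], so the hypothesis gives
    [#|X|^2 <= #|Q|] and some [xi] in [Q] makes [X + xi X] of size at least [#|X|^2 / 2].
    In all cases [A + xi A], which contains a translate of [X + xi X], has at most
    [(8 K^4)^8 N] elements, whence [N <= 2^27 K^32].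
    In characteristic 2, where one cannot halve, the hypothesis for the prime field already
    forces [N <= 1]. *)
Require Import Defs.
From HB Require Import structures.
From mathcomp Require Import all_boot all_order all_algebra.
From mathcomp Require Import reals exp.
From mathcomp Require Import ring lra zify.

Set Implicit Arguments.
Unset Strict Implicit.
Unset Printing Implicit Defensive.

Import Order.TTheory GRing.Theory Num.Theory.
Local Open Scope ring_scope.

(** * Sumsets and dilates *)

Definition dil (F : finFieldType) (c : F) (X : {set F}) : {set F} :=
  [set c * x | x in X].

Arguments dil {F} c%_R X.

Definition nfold (F : finFieldType) (n : nat) (X : {set F}) : {set F} :=
  iter n (sumset X) [set 0].

Lemma mem_sumset (F : finFieldType) (X Y : {set F}) x y :
  x \in X -> y \in Y -> x + y \in sumset X Y.
Proof. exact: imset2_f. Qed.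

Lemma mem_dil (F : finFieldType) (X : {set F}) c x : x \in X -> c * x \in dil c X.
Proof. exact: imset_f. Qed.

Lemma sumsetC (F : finFieldType) (X Y : {set F}) : sumset X Y = sumset Y X.
Proof.
by apply/setP=> z; apply/imset2P/imset2P=> -[x y hx hy ->]; exists y x; rewrite // addrC.
Qed.

Lemma sumsetA (F : finFieldType) (X Y Z : {set F}) :
  sumset X (sumset Y Z) = sumset (sumset X Y) Z.
Proof.
apply/setP=> t; apply/imset2P/imset2P.
- case=> x _ hx /imset2P[y z hy hz ->] ->.
  by exists (x + y) z; rewrite ?addrA ?mem_sumset.
- case=> _ z /imset2P[x y hx hy ->] hz ->.
  by exists x (y + z); rewrite ?addrA ?mem_sumset.
Qed.

Lemma sumsetCA (F : finFieldType) (X Y Z : {set F}) :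
  sumset X (sumset Y Z) = sumset Y (sumset X Z).
Proof. by rewrite !sumsetA (sumsetC X Y). Qed.

Lemma sumsetACA (F : finFieldType) (X Y Z T : {set F}) :
  sumset (sumset X Y) (sumset Z T) = sumset (sumset X Z) (sumset Y T).
Proof. by rewrite -!sumsetA (sumsetCA Y). Qed.

Lemma sumset0 (F : finFieldType) (X : {set F}) : sumset X [set 0] = X.
Proof.
apply/setP=> t; apply/imset2P/idP.
- by case=> x y hx /set1P-> ->; rewrite addr0.
- by move=> ht; exists t 0; rewrite ?addr0 ?set11.
Qed.

Lemma sumset_set0 (F : finFieldType) (X : {set F}) : sumset X set0 = set0.
Proof. by apply/setP=> t; rewrite inE; apply/imset2P=> -[x y _]; rewrite inE. Qed.

Lemma sumsetS (F : finFieldType) (X X' Y Y' : {set F}) :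
  X \subset X' -> Y \subset Y' -> sumset X Y \subset sumset X' Y'.
Proof. exact: imset2S. Qed.

Lemma card_translate (F : finFieldType) (X : {set F}) t : #|sumset X [set t]| = #|X|.
Proof.
have -> : sumset X [set t] = [set x + t | x in X].
  apply/setP=> z; apply/imset2P/imsetP.
  - by case=> x y hx /set1P-> ->; exists x.
  - by case=> x hx ->; exists x t; rewrite ?set11.
by rewrite card_imset //; apply: addIr.
Qed.

Lemma card_dil_le (F : finFieldType) c (X : {set F}) : (#|dil c X| <= #|X|)%N.
Proof. exact: leq_imset_card. Qed.

Lemma card_dil (F : finFieldType) c (X : {set F}) : c != 0 -> #|dil c X| = #|X|.
Proof. by move=> c0; rewrite card_imset //; apply: mulfI. Qed.

Lemma dil_sumset (F : finFieldType) c (X Y : {set F}) :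
  dil c (sumset X Y) = sumset (dil c X) (dil c Y).
Proof.
apply/setP=> t; apply/imsetP/imset2P.
- case=> _ /imset2P[x y hx hy ->] ->.
  by exists (c * x) (c * y); rewrite ?mulrDr ?mem_dil.
- case=> _ _ /imsetP[x hx ->] /imsetP[y hy ->] ->.
  by exists (x + y); rewrite ?mulrDr ?mem_sumset.
Qed.

Lemma dilM (F : finFieldType) c d (X : {set F}) : dil c (dil d X) = dil (c * d) X.
Proof. by rewrite /dil -imset_comp; apply: eq_imset => x /=; rewrite mulrA. Qed.

Lemma dil_nfold (F : finFieldType) c n (X : {set F}) :
  dil c (nfold n X) = nfold n (dil c X).
Proof.
elim: n => [|n IH] /=; last by rewrite dil_sumset IH.
by rewrite /dil imset_set1 mulr0.
Qed.

Lemma nfold_sumset (F : finFieldType) n (X Y : {set F}) :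
  nfold n (sumset X Y) = sumset (nfold n X) (nfold n Y).
Proof. by elim: n => [|n IH] /=; rewrite ?sumset0 // IH sumsetACA. Qed.

Lemma leq_card_sumset (F : finFieldType) (X Y : {set F}) (y : F) :
  y \in Y -> (#|X| <= #|sumset X Y|)%N.
Proof.
move=> hy; rewrite -(card_translate X y) subset_leq_card //.
by apply: sumsetS => //; rewrite sub1set.
Qed.

(** * The Ruzsa triangle and Pluennecke inequalities *)

(** Fix one representation [t = x + z] for each [t] in [X + Z]. The pair [(t, y)] is recovered from
    [(x + y, - y + z)]: the coordinates add up to [t], which determines [x] and then [y]. *)
Lemma ruzsa_triangle (F : finFieldType) (X Y Z : {set F}) :
  (#|sumset X Z| * #|Y| <= #|sumset X Y| * #|sumset (dil (-1) Y) Z|)%N.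
Proof.
pose w (t : F) : F * F :=
  odflt (0, 0) [pick p : F * F | [&& p.1 \in X, p.2 \in Z & t == p.1 + p.2]].
have wP t : t \in sumset X Z ->
    [/\ (w t).1 \in X, (w t).2 \in Z & t = (w t).1 + (w t).2].
  case/imset2P=> x z hx hz def_t; rewrite /w; case: pickP => [p /and3P[? ? /eqP ?] //|].
  by move/(_ (x, z)); rewrite /= hx hz def_t eqxx.
pose f (q : F * F) := ((w q.1).1 + q.2, - q.2 + (w q.1).2).
rewrite -!cardsX -(@card_in_imset _ _ f) ?subset_leq_card //.
- apply/subsetP=> _ /imsetP[[t y] /setXP[ht hy] ->].
  have [wX wZ _] := wP t ht.
  by rewrite inE /= mem_sumset // mem_sumset // -(mulN1r y) mem_dil.
- move=> [t y] [t' y'] /setXP[ht hy] /setXP[ht' hy'] [] /= e1 e2.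
  have [_ _ et] := wP t ht; have [_ _ et'] := wP t' ht'.
  have tt' : t = t'.
    rewrite et et'; transitivity (((w t).1 + y) + (- y + (w t).2)); first by ring.
    by rewrite e1 e2; ring.
  by move: e1; rewrite tt' => /addrI ->.
Qed.

(* Petridis: one adds the elements of C one at a time. When c is added, the part Z of X
   with Z + B + c already covered contains every x for which x + c was already in X + C. *)
Lemma petridis (F : finFieldType) (X B C : {set F}) :
  (forall Z : {set F}, Z \subset X ->
     #|sumset X B| * #|Z| <= #|sumset Z B| * #|X|)%N ->
  (#|sumset (sumset X B) C| * #|X| <= #|sumset X B| * #|sumset X C|)%N.
Proof.
move=> minX; have [n] := ubnP #|C|; elim: n C => // n IH C hC.
have [->|[c cC]] := set_0Vmem C; first by rewrite !sumset_set0 !cards0 mul0n.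
set C' := C :\ c.
have /IH {}IH : (#|C'| < n)%N by move: hC; rewrite (cardsD1 c C) cC.
pose Z := [set x in X | sumset (sumset [set x] B) [set c] \subset sumset (sumset X B) C'].
have ZX : Z \subset X by apply/subsetP=> x; rewrite inE => /andP[].
have CE : C = c |: C' by rewrite setD1K.
have sumU (Y : {set F}) : sumset Y C = sumset Y C' :|: sumset Y [set c].
  apply/setP=> t; rewrite inE CE; apply/imset2P/orP.
  - case=> y z hy /setU1P[->|hz] ->; [right|left]; apply: mem_sumset => //; exact: set11.
  - by case=> /imset2P[y z hy hz ->]; exists y z; rewrite // in_setU1 ?hz ?orbT //;
       move: hz; rewrite inE => ->.
have up : (#|sumset (sumset X B) C| + #|sumset Z B|
            <= #|sumset (sumset X B) C'| + #|sumset X B|)%N.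
  rewrite sumU cardsU card_translate -(card_translate (sumset Z B) c).
  set U := sumset (sumset X B) C'; set V := sumset (sumset X B) [set c].
  have : (#|sumset (sumset Z B) [set c]| <= #|U :&: V|)%N.
    apply: subset_leq_card; apply/subsetIP; split; last first.
      by apply: sumsetS => //; apply: sumsetS.
    apply/subsetP=> _ /imset2P[_ _ /imset2P[z b hz hb ->] /set1P-> ->].
    move: hz; rewrite inE => /andP[_ /subsetP]; apply.
    by rewrite !mem_sumset ?set11.
  have := subset_leq_card (subsetIr U V); rewrite (card_translate (sumset X B)).
  lia.
have lo : (#|sumset X C'| + #|X| <= #|sumset X C| + #|Z|)%N.
  rewrite sumU cardsU card_translate.
  have : (#|sumset X C' :&: sumset X [set c]| <= #|Z|)%N.
    rewrite -(card_translate Z c); apply/subset_leq_card/subsetP=> t.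
    case/setIP=> ht /imset2P[x _ hx /set1P-> def_t].
    rewrite def_t mem_sumset ?set11 // inE hx /=.
    apply/subsetP=> _ /imset2P[_ _ /imset2P[_ b /set1P-> hb ->] /set1P-> ->].
    move: ht; rewrite def_t => /imset2P[x' c' hx' hc' e].
    have -> : x + b + c = (x' + b) + c' by rewrite addrAC e addrAC.
    by rewrite !mem_sumset.
  have := subset_leq_card (subsetIl (sumset X C') (sumset X [set c])).
  lia.
(* Add [up] times [#|X|] and [lo] times [#|sumset X B|]; [minX] absorbs the terms in [Z]. *)
have := minX Z ZX.
have := leq_mul up (leqnn #|X|); have := leq_mul (leqnn #|sumset X B|) lo.
rewrite !mulnDl !mulnDr; move: IH; lia.
Qed.

(** A nonempty [X] in [B] minimising [#|X + B| / #|X|] satisfies the hypothesis of [petridis], so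
    each further summand [B] costs at most a factor [#|B + B| / #|B|]. The triangle inequality
    through [X] then bounds the difference set. *)
Lemma plunnecke (F : finFieldType) (B : {set F}) n : (0 < #|B|)%N ->
  (#|sumset (nfold n B) (dil (-1) (nfold n B))| * #|B| ^ n.*2
     <= #|sumset B B| ^ n.*2 * #|B|)%N.
Proof.
move=> B0.
have [X [X0 XB minX ratX]] : exists X : {set F}, [/\ (0 < #|X|)%N, X \subset B,
    (forall Z : {set F}, Z \subset X ->
       #|sumset X B| * #|Z| <= #|sumset Z B| * #|X|)%N &
    (#|sumset X B| * #|B| <= #|sumset B B| * #|X|)%N].
  pose ok (X : {set F}) := (0 < #|X|)%N && (X \subset B).
  have okB : ok B by rewrite /ok B0 subxx.
  pose f (X : {set F}) : rat := #|sumset X B|%:R / #|X|%:R.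
  have [X /andP[X0 XB] minX] := @arg_minP _ _ _ B ok f okB.
  have key Z : ok Z -> (#|sumset X B| * #|Z| <= #|sumset Z B| * #|X|)%N.
    move=> okZ; have := minX Z okZ; case/andP: okZ => Z0 _.
    by rewrite /f ler_pdivrMr ?ltr0n // mulrAC ler_pdivlMr ?ltr0n // -!natrM ler_nat.
  exists X; split => //; last exact: key.
  move=> Z ZX; have [->|Z0] := posnP #|Z|; first by rewrite muln0.
  by apply: key; rewrite /ok Z0 (subset_trans ZX).
have iterX m : (#|sumset X (nfold m B)| * #|B| ^ m <= #|sumset B B| ^ m * #|X|)%N.
  elim: m => [|m IH] /=; first by rewrite sumset0 muln1 mul1n.
  have := petridis (nfold m B) minX; rewrite -sumsetA => h.
  rewrite -(leq_pmul2r X0) !expnS.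
  apply: (@leq_trans (#|sumset X B| * #|B| * (#|sumset X (nfold m B)| * #|B| ^ m))).
    by rewrite mulnAC (mulnACA #|sumset X B|) leq_mul.
  by rewrite -[leqRHS]mulnA (mulnACA #|sumset B B|) leq_mul.
have := ruzsa_triangle (nfold n B) X (dil (-1) (nfold n B)).
rewrite -dil_sumset card_dil ?oppr_eq0 ?oner_eq0 // (sumsetC _ X) => tri.
rewrite -(leq_pmul2r X0) -addnn !expnD.
apply: (@leq_trans ((#|sumset X (nfold n B)| * #|B| ^ n) *
                    (#|sumset X (nfold n B)| * #|B| ^ n))).
  by rewrite mulnAC [leqRHS]mulnACA leq_mul.
apply: leq_trans (leq_mul (iterX n) (iterX n)) _.
by rewrite mulnACA -[leqRHS]mulnA leq_mul // leq_mul ?subset_leq_card.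
Qed.

(** * Squares and popular sums *)

(** The chosen square roots [w y] and their negatives cover [A]. *)
Lemma card_square_set (F : finFieldType) (A : {set F}) : (#|A| <= 2 * #|square_set A|)%N.
Proof.
pose w y := odflt 0 [pick x in A | x ^+ 2 == y].
have cov : A \subset (w @: square_set A) :|: (dil (-1) (w @: square_set A)).
  apply/subsetP=> x xA; have y2 : x ^+ 2 \in square_set A by apply: imset_f.
  have : w (x ^+ 2) ^+ 2 == x ^+ 2.
    by rewrite /w; case: pickP => [z /andP[] //|/(_ x)]; rewrite xA eqxx.
  rewrite inE eqf_sqr => /orP[/eqP <-|/eqP e]; first by rewrite imset_f.
  by rewrite -[x]opprK -e -(mulN1r (w _)) mem_dil ?orbT // imset_f.
apply: leq_trans (subset_leq_card cov) _.
apply: leq_trans (leq_card_setU _ _) _; rewrite mul2n -addnn leq_add //.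
  exact: leq_imset_card.
by apply: leq_trans (card_dil_le _ _) _; apply: leq_imset_card.
Qed.

(** Its size counts the ordered representations of [s] as a sum of two elements of [A]. *)
Definition rep (F : finFieldType) (A : {set F}) (s : F) : {set F} :=
  [set a in A | s - a \in A].

Definition half_diff (F : finFieldType) (B : {set F}) : {set F} :=
  dil 2%:R^-1 (sumset B (dil (-1) B)).

(* Since [s * (2 * p - s) = p ^+ 2 - (s - p) ^+ 2], the set [s * rep A s] lies in a
   translate of [half_diff (square_set A)]. As [rep A s] is symmetric under
   [p |-> s - p], the Ruzsa triangle inequality through it costs only [A + A]. *)
Lemma card_sumset_dil (F : finFieldType) (A T : {set F}) (c s : F) :
  2%:R != 0 :> F -> c = s \/ c = - s ->
  (#|sumset T (dil c A)| * #|rep A s|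
     <= #|sumset T (half_diff (square_set A))| * #|sumset A A|)%N.
Proof.
(* The sum [s] may be [0], and dilation by [c] is then not invertible; in that case [0] in
   [half_diff] and [#|A| <= #|A + A|] suffice. *)
move=> two0 hc; have [->|c0] := eqVneq c 0.
  have [->|[a aA]] := set_0Vmem A.
    suff -> : rep set0 s = set0 :> {set F} by rewrite cards0 muln0.
    by apply/setP=> x; rewrite !inE.
  have -> : dil 0 A = [set 0].
    apply/setP=> x; rewrite inE; apply/imsetP/eqP=> [[y _ ->]|->]; first by rewrite mul0r.
    by exists a; rewrite ?mul0r.
  rewrite card_translate leq_mul //.
    apply: (leq_card_sumset T (y := 0)); rewrite -(mulr0 2%:R^-1) mem_dil //.
    have a2 : a ^+ 2 \in square_set A by apply: imset_f.
    by rewrite -(subrr (a ^+ 2)) -(mulN1r (a ^+ 2)) mem_sumset ?mem_dil.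
  apply: leq_trans (leq_card_sumset A aA); apply/subset_leq_card/subsetP=> x.
  by rewrite inE => /andP[].
rewrite -(card_dil (rep A s) c0).
apply: leq_trans (ruzsa_triangle _ _ _) _; apply: leq_mul.
  pose t := 2%:R^-1 * (c * s).
  rewrite -(card_translate (sumset T (half_diff _)) t) -sumsetA.
  apply: subset_leq_card; apply: sumsetS => //.
  apply/subsetP=> _ /imsetP[p hp ->]; move: hp; rewrite inE => /andP[pA spA].
  have p2 : p ^+ 2 \in square_set A by apply: imset_f.
  have q2 : (s - p) ^+ 2 \in square_set A by apply: imset_f.
  case: hc => ec.
    have -> : c * p = 2%:R^-1 * (p ^+ 2 + -1 * (s - p) ^+ 2) + t.
      by rewrite /t ec; field.
    by rewrite !(mem_sumset, mem_dil) ?set11.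
  (* For [c = - s] the two squares change places. *)
  have -> : c * p = 2%:R^-1 * ((s - p) ^+ 2 + -1 * p ^+ 2) + t.
    by rewrite /t ec; field.
  by rewrite !(mem_sumset, mem_dil) ?set11.
rewrite -(card_dil (sumset A A) c0) -(card_translate (dil c _) (- (c * s))).
apply: subset_leq_card; apply/subsetP=> _ /imset2P[_ _ /imsetP[_ /imsetP[p hp ->] ->]
  /imsetP[a aA ->] ->].
move: hp; rewrite inE => /andP[pA spA].
have -> : -1 * (c * p) + c * a = c * ((s - p) + a) + - (c * s) by ring.
by rewrite mem_sumset ?set11 // mem_dil // mem_sumset.
Qed.

(** Both sides count the pairs in [A x A] whose sum satisfies [Q], grouped by one entry or by the
    sum. *)
Lemma sum_card_rep (F : finFieldType) (A : {set F}) (Q : pred F) :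
  (\sum_(b in A) #|[set a in A | Q (a + b)%R]| = \sum_(s in sumset A A | Q s) #|rep A s|)%N.
Proof.
transitivity (\sum_(b in A) \sum_(s | ((s - b)%R \in A) && Q s) 1)%N.
  apply: eq_bigr => b _; rewrite -sum1_card (reindex_inj (addIr (- b))) /=.
  by apply: eq_bigl => s; rewrite inE subrK.
rewrite (exchange_big_dep (mem (predI (mem (sumset A A)) Q))) /=.
  apply: eq_bigr => s /andP[_ Qs]; rewrite -sum1_card; apply: eq_bigl => b.
  by rewrite !inE Qs andbT.
by move=> b s bA /andP[sA Qs]; apply/andP; split => //; rewrite -(subrK b s); apply: mem_sumset.
Qed.

(** With [N = #|A|], an unpopular sum has fewer than [N ^ 2 / (2 #|A + A|)] representations, so
    unpopular sums account for at most half of the [N ^ 2] pairs. Some [b] attains the average over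
    the remaining pairs. *)
Lemma popular_sums (F : finFieldType) (A : {set F}) : (0 < #|A|)%N ->
  exists2 b, b \in A & (#|A| <=
    2 * #|[set a in A | #|A| ^ 2 <= 2 * #|sumset A A| * #|rep A (a + b)%R|]|)%N.
Proof.
move=> A0; set S := sumset A A; pose Q s := (#|A| ^ 2 <= 2 * #|S| * #|rep A s|)%N.
have S0 : (0 < #|S|)%N.
  have /card_gt0P[a aA] := A0.
  by rewrite (leq_trans A0) // (leq_card_sumset _ aA).
apply/exists_inP; apply: contraT; rewrite negb_exists_in => /forall_inP noB.
have unpop : (2 * \sum_(b in A) #|[set a in A | ~~ Q (a + b)%R]| <= #|A| ^ 2)%N.
  rewrite (sum_card_rep A (predC Q)) -(leq_pmul2l S0) mulnA big_distrr /=.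
  rewrite -[leqRHS]sum_nat_const.
  rewrite [leqRHS](bigID Q) /= -[leqLHS]add0n leq_add //.
  apply: leq_sum => s /andP[_]; rewrite -ltnNge => /ltnW.
  by rewrite (mulnC #|S|).
have total : (\sum_(b in A) #|[set a in A | Q (a + b)%R]|
              + \sum_(b in A) #|[set a in A | ~~ Q (a + b)%R]| = #|A| ^ 2)%N.
  rewrite -big_split /= -mulnn -sum_nat_const; apply: eq_bigr => b _.
  rewrite -(cardsID [set a | Q (a + b)%R] A); congr (_ + _)%N; apply: eq_card => a.
    by rewrite !inE.
  by rewrite !inE andbC.
have pop : (2 * \sum_(b in A) #|[set a in A | Q (a + b)%R]| < #|A| ^ 2)%N.
  rewrite big_distrr /= -mulnn -sum_nat_const.
  (* The bound [#|A| - 1] for each term keeps the inequality strict after summing over the nonempty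
     [A]. *)
  apply: (@leq_trans (\sum_(b in A) #|A|.-1).+1).
    rewrite ltnS; apply: leq_sum => b bA.
    by move: (noB b bA); rewrite -ltnNge => ?; rewrite -ltnS (prednK A0).
  by rewrite !sum_nat_const -[X in (_ <= _ * X)%N](prednK A0) mulnS; lia.
lia.
Qed.

(** * Sums of many dilates *)

Definition dilsum (F : finFieldType) (A : {set F}) (cs : seq F) : {set F} :=
  foldr (fun c Y => sumset (dil c A) Y) [set 0] cs.

Lemma dilsum_cat (F : finFieldType) (A : {set F}) (cs ds : seq F) :
  dilsum A (cs ++ ds) = sumset (dilsum A cs) (dilsum A ds).
Proof.
by elim: cs => [|c cs /= ->]; rewrite ?sumsetA // sumsetC sumset0.
Qed.

Lemma dil_sum_sub (F : finFieldType) (A : {set F}) (cs : seq F) :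
  dil (\sum_(c <- cs) c) A \subset dilsum A cs.
Proof.
elim: cs => [|c cs /subsetP IH]; apply/subsetP=> _ /imsetP[a aA ->].
  by rewrite big_nil mul0r set11.
by rewrite big_cons mulrDl mem_sumset ?mem_dil // IH // mem_dil.
Qed.

(** Multiplication by [v] turns the left side into [v A + u A], and a dilate by a sum lies in the
    sum of the dilates. *)
Lemma card_sumset_ratio (F : finFieldType) (A : {set F}) (cs ds : seq F) (u v : F) :
  v != 0 -> v = \sum_(c <- cs) c -> u = \sum_(c <- ds) c ->
  (#|sumset A (dil (u / v) A)| <= #|dilsum A (cs ++ ds)|)%N.
Proof.
move=> v0 ev eu; rewrite -(card_dil (sumset _ _) v0) dil_sumset dilM mulrCA divff // mulr1.
by rewrite dilsum_cat subset_leq_card // sumsetS // ?ev ?eu dil_sum_sub.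
Qed.

(** Since the bound for one [c] holds for every [T], the dilates are exchanged for copies of [W] one
    at a time, the other summands being absorbed into [T]. *)
Lemma card_sumset_dilsum (R : realFieldType) (F : finFieldType) (A W : {set F})
    (l : R) (cs : seq F) : 0 <= l ->
  (forall c, c \in cs -> forall T : {set F},
     #|sumset T (dil c A)|%:R <= l * #|sumset T W|%:R) ->
  forall T : {set F}, #|sumset T (dilsum A cs)|%:R
    <= l ^+ size cs * #|sumset T (nfold (size cs) W)|%:R.
Proof.
move=> l0; elim: cs => [|c cs IH] good T /=; first by rewrite mul1r.
rewrite (sumsetC (dil c A)) sumsetA; apply: le_trans (good c (mem_head _ _) _) _.
rewrite -sumsetA (sumsetC (dilsum A cs)) !sumsetA exprS -mulrA ler_wpM2l //.
by apply: IH => d hd; apply: good; rewrite inE hd orbT.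
Qed.

Lemma card_nfold_half_diff (R : realFieldType) (F : finFieldType) (B : {set F}) n :
  (0 < #|B|)%N ->
  (#|nfold n (half_diff B)|%:R : R)
    <= (#|sumset B B|%:R / #|B|%:R) ^+ n.*2 * #|B|%:R.
Proof.
move=> B0; rewrite expr_div_n mulrAC ler_pdivlMr ?exprn_gt0 ?ltr0n //.
rewrite -!natrX -!natrM ler_nat; apply: leq_trans (plunnecke n B0).
rewrite leq_mul // -dil_nfold nfold_sumset -dil_nfold.
exact: card_dil_le.
Qed.

(** With [K = M / #|A|], exchanging a popular dilate for [W] costs [2 K ^ 2]. Pluennecke then costs
    [(2 K) ^ 2] for each copy of [W], the [2] coming from [#|B| >= #|A| / 2] for the set [B] of
    squares. *)
Lemma card_dilsum_popular (R : realFieldType) (F : finFieldType) (A : {set F})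
    (M : nat) (cs : seq F) :
  2%:R != 0 :> F -> (0 < #|A|)%N ->
  (#|sumset A A| <= M)%N -> (#|sumset (square_set A) (square_set A)| <= M)%N ->
  (forall c, c \in cs -> exists2 s, c = s \/ c = - s &
     (#|A| ^ 2 <= 2 * #|sumset A A| * #|rep A s|)%N) ->
  (#|dilsum A cs|%:R : R) <= (8%:R * (M%:R / #|A|%:R) ^+ 4) ^+ size cs * #|A|%:R.
Proof.
move=> two0 A0 hS hB pop; set N : R := #|A|%:R; set m : R := M%:R.
have N0 : 0 < N by rewrite ltr0n.
have B0 : (0 < #|square_set A|)%N by have := card_square_set A; lia.
set K := m / N; have K0 : 0 <= K by rewrite divr_ge0 ?ler0n.
pose W := half_diff (square_set A).
have good c : c \in cs -> forall T : {set F},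
    (#|sumset T (dil c A)|%:R : R) <= (2%:R * K ^+ 2) * #|sumset T W|%:R.
  move=> /pop[s hc hs] T.
  have h1 := card_sumset_dil A T two0 hc.
  set a := #|sumset T _| in h1 *; set b := #|sumset T W|; rewrite -/W -/b in h1.
  have h2 : (a * #|A| ^ 2 <= 2 * M ^ 2 * b)%N.
    have := leq_mul (leqnn a) hs.
    have := leq_mul h1 (leqnn (2 * #|sumset A A|)).
    have : (b * (#|sumset A A| * (2 * #|sumset A A|)) <= b * (2 * M ^ 2))%N.
      by rewrite leq_mul // mulnCA -mulnn leq_mul // leq_mul.
    move: (#|sumset A A|) (#|rep A s|) (#|A| ^ 2)%N (M ^ 2)%N => p q r t; nia.
  rewrite /K expr_div_n mulrA mulrAC ler_pdivlMr ?exprn_gt0 //.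
  by rewrite -!natrX -!natrM ler_nat.
have l0 : 0 <= 2%:R * K ^+ 2 by rewrite mulr_ge0 ?exprn_ge0.
have := card_sumset_dilsum l0 good [set 0].
rewrite !(sumsetC [set 0]) !sumset0 => h; apply: le_trans h _.
have -> : 8%:R * K ^+ 4 = (2%:R * K ^+ 2) * (2%:R * K) ^+ 2 by ring.
rewrite [X in _ <= X * _]exprMn -mulrA (ler_wpM2l (exprn_ge0 _ l0)) //.
apply: le_trans (card_nfold_half_diff R _ B0) _.
rewrite -exprM mul2n ler_pM ?exprn_ge0 ?divr_ge0 ?ler0n //.
  rewrite lerXn2r ?nnegrE ?mulr_ge0 ?invr_ge0 ?ler0n //.
  rewrite /K mulrA ler_pdivrMr ?ltr0n // mulrAC ler_pdivlMr //.
  rewrite -!natrM ler_nat; have := leq_mul hB (card_square_set A); lia.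
by rewrite ler_nat leq_imset_card.
Qed.

(** * The set of quotients of differences *)

(* Pairs with [c = d] are excluded: [x / 0 = 0] would add [0] even when [X] is a singleton. *)
Definition quot (F : finFieldType) (X : {set F}) : {set F} :=
  [set (p.1.1 - p.1.2) / (p.2.1 - p.2.2)
     | p in [set p : (F * F) * (F * F) | [&& p.1.1 \in X, p.1.2 \in X, p.2.1 \in X,
                                             p.2.2 \in X & p.2.1 != p.2.2]]].

Lemma quotP (F : finFieldType) (X : {set F}) (r : F) :
  reflect (exists a b c d, [/\ a \in X, b \in X, c \in X, d \in X &
             c != d /\ r = (a - b) / (c - d)])
    (r \in quot X).
Proof.
apply: (iffP imsetP) => [[[[a b] [c d]]]|[a [b [c [d [aX bX cX dX [cd ->]]]]]]].
  by rewrite inE /= => /and5P[aX bX cX dX cd] ->; exists a, b, c, d.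
by exists ((a, b), (c, d)); rewrite // inE /= aX bX cX dX.
Qed.

(** A collision [a + xi b = c + xi d] with [b != d] would give [xi = (a - c) / (d - b)], an element
    of [quot X]. *)
Lemma card_sumset_notin_quot (F : finFieldType) (X : {set F}) (xi : F) :
  xi \notin quot X -> #|sumset X (dil xi X)| = (#|X| ^ 2)%N.
Proof.
move=> hxi; rewrite -mulnn -cardsX.
have -> : sumset X (dil xi X) = [set p.1 + xi * p.2 | p in setX X X].
  apply/setP=> t; apply/imset2P/imsetP => [[x _ xX /imsetP[y yX ->] ->]|].
    by exists (x, y); rewrite // inE xX.
  by case=> -[x y] /setXP[xX yX] ->; exists x (xi * y); rewrite ?mem_dil.
apply: card_in_imset => -[a b] [c d] /setXP[aX bX] /setXP[cX dX] /= e.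
have [db|db] := eqVneq d b; first by move: e; rewrite db => /addIr ->.
case/negP: hxi; apply/quotP; exists a, c, d, b; split => //; split => //.
apply: (canRL (mulfK _)); first by rewrite subr_eq0.
apply: subr0_eq; transitivity (c + xi * d - (a + xi * b)); first by ring.
by rewrite e subrr.
Qed.

Lemma quot0 (F : finFieldType) (X : {set F}) : (1 < #|X|)%N -> 0 \in quot X.
Proof.
case/card_gt1P=> x [y [xX yX xy]]; apply/quotP.
by exists x, x, x, y; split => //; split; rewrite // subrr mul0r.
Qed.

Lemma quot1 (F : finFieldType) (X : {set F}) : (1 < #|X|)%N -> 1 \in quot X.
Proof.
case/card_gt1P=> x [y [xX yX xy]]; apply/quotP.
by exists x, y, x, y; split => //; split; rewrite // divff // subr_eq0.
Qed.

Lemma quotN (F : finFieldType) (X : {set F}) r : r \in quot X -> - r \in quot X.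
Proof.
case/quotP=> a [b [c [d [aX bX cX dX [cd ->]]]]]; apply/quotP.
by exists b, a, c, d; split => //; split; rewrite // -mulNr opprB.
Qed.

Lemma quotV (F : finFieldType) (X : {set F}) r : r \in quot X -> r^-1 \in quot X.
Proof.
have [->|r0] := eqVneq r 0; first by rewrite invr0.
case/quotP=> a [b [c [d [aX bX cX dX [cd def_r]]]]]; apply/quotP.
exists c, d, a, b; split => //; split; last by rewrite def_r invf_div.
by apply: contraNneq r0 => ab; rewrite def_r ab subrr mul0r.
Qed.

(* Closure under differences reduces to closure under [r |-> r + 1] because
   [x - y = y * (x / y - 1)]. *)
Lemma quot_subfield (F : finFieldType) (X : {set F}) : (1 < #|X|)%N ->
  {in quot X &, forall r s, r * s \in quot X} ->
  {in quot X, forall r, r + 1 \in quot X} -> is_subfield (quot X).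
Proof.
move=> X1 mulR addR.
have divR : {in quot X &, forall r s, r / s \in quot X}.
  by move=> r s rR sR; apply: mulR; rewrite ?quotV.
split=> //; first exact: quot1.
move=> x y xR yR; have [->|y0] := eqVneq y 0; first by rewrite subr0.
have -> : x - y = y * - (- (x / y) + 1) by rewrite opprD opprK mulrBr mulr1 mulrC divfK.
by apply: mulR; rewrite ?quotN ?addR ?quotN ?divR.
Qed.

(** * Collisions and large dilates *)

(** Cauchy-Schwarz, by summing [2 c_i c_j <= c_i ^ 2 + c_j ^ 2] over all pairs. *)
Lemma sqr_sum_leq (I : finType) (D : {set I}) (c : I -> nat) :
  ((\sum_(i in D) c i) ^ 2 <= #|D| * \sum_(i in D) c i ^ 2)%N.
Proof.
rewrite -(leq_pmul2l (isT : 0 < 2)%N) -mulnn.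
rewrite [X in (2 * X <= _)%N]big_distrlr big_distrr /=.
apply: (@leq_trans (\sum_(i in D) \sum_(j in D) (c i ^ 2 + c j ^ 2))).
  apply: leq_sum => i _; rewrite big_distrr /=; apply: leq_sum => j _.
  exact: nat_Cauchy.
under eq_bigr do rewrite big_split /= sum_nat_const.
by rewrite big_split /= sum_nat_const -big_distrr /= mul2n -addnn.
Qed.

(** The double sum is the sum of the squared fibre sizes of [f], so Cauchy-Schwarz over the image
    applies. *)
Lemma card_imset_collisions (T U : finType) (f : T -> U) (D : {set T}) :
  (#|D| ^ 2 <= #|f @: D| *
     \sum_(p in D) \sum_(q in D) (f p == f q))%N.
Proof.
have fibre s : (\sum_(p in D | f p == s) 1 = #|[set p in D | f p == s]|)%N.
  by rewrite -sum1_card; apply: eq_bigl => p; rewrite inE.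
have -> : #|D| = (\sum_(s in f @: D) #|[set p in D | f p == s]|)%N.
  rewrite -sum1_card (partition_big_imset f) /=.
  by apply: eq_bigr => s _; rewrite fibre.
apply: leq_trans (sqr_sum_leq _ _) _; rewrite leq_mul2l; apply/orP; right.
rewrite (partition_big_imset f) /=; apply: leq_sum => s _.
rewrite -mulnn -{1}fibre big_distrl /=; apply: leq_sum => p /andP[_ /eqP fp].
rewrite mul1n -fibre big_mkcondr /= leq_sum // => q _.
by rewrite fp eq_sym; case: eqP.
Qed.

(* Averaging the number of collisions [a + xi * b = c + xi * d] over [xi] in [G]: distinct
   pairs collide for at most one [xi]. *)
Lemma exists_large_dilate (F : finFieldType) (X G : {set F}) :
  (0 < #|X|)%N -> (#|X| ^ 2 <= #|G|)%N ->
  exists2 xi, xi \in G & (#|X| ^ 2 <= 2 * #|sumset X (dil xi X)|)%N.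
Proof.
move=> X0 XG; pose D := setX X X; pose f (xi : F) (p : F * F) := p.1 + xi * p.2.
pose coll xi := (\sum_(p in D) \sum_(q in D) (f xi p == f xi q))%N.
have cardD : #|D| = (#|X| ^ 2)%N by rewrite cardsX mulnn.
have [xi xiG hxi] : exists2 xi, xi \in G & (coll xi <= 2 * #|D|)%N.
  apply/exists_inP; apply: contraT; rewrite negb_exists_in => /forall_inP big.
  have lo : (#|G| * (2 * #|D|).+1 <= \sum_(xi in G) coll xi)%N.
    rewrite -sum_nat_const; apply: leq_sum => xi xiG.
    by rewrite ltnNge big.
  (* For fixed [p], the term [q = p] contributes at most [#|G|] and every other [q] at most [1]. *)
  have up : (\sum_(xi in G) coll xi <= #|D| * (#|G| + #|D|))%N.
    rewrite exchange_big /= -sum_nat_const; apply: leq_sum => p pD.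
    rewrite exchange_big /= (bigD1 p) //= leq_add //.
      by rewrite -sum1_card leq_sum // => xi _; rewrite leq_b1.
    apply: (@leq_trans (\sum_(q in D | q != p) 1)); last first.
      by rewrite big_mkcondr /= -sum1_card leq_sum // => q _; case: ifP.
    apply: leq_sum => q /andP[_ qp].
    have [[xi /andP[xiG /eqP exi]]|none] :=
      altP (@existsP _ (fun xi => (xi \in G) && (f xi p == f xi q))); last first.
      rewrite big1 // => xi xiG; case: eqP => // e.
      by case/existsP: none; exists xi; rewrite xiG e eqxx.
    rewrite (bigD1 xi) //= exi eqxx big1 ?addn0 // => eta /andP[_ ne].
    case: eqP => // eeta; case/eqP: qp.
    move: p q {pD} exi eeta => [a b] [c d]; rewrite /f /= => exi eeta.
    have : (eta - xi) * (b - d) == 0.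
      apply/eqP; transitivity ((a + eta * b) - (c + eta * d)
                               - ((a + xi * b) - (c + xi * d))); first by ring.
      by rewrite exi eeta !subrr.
    rewrite mulf_eq0 !subr_eq0 (negbTE ne) => /eqP bd.
    by move: exi; rewrite bd => /addIr ->.
  have G0 : (0 < #|G|)%N by apply: leq_trans XG; rewrite expn_gt0 X0.
  (* As [#|D| <= #|G|], the average over [G] is at most [2 #|D|], against the assumed
     [2 #|D| + 1]. *)
  have : (#|D| * (#|G| + #|D|) <= #|G| * (2 * #|D|))%N.
    rewrite [leqRHS]mulnCA mul2n -addnn -mulnDl mulnC leq_mul // leq_add2l.
    by rewrite cardD.
  by move/(leq_trans up)/(leq_trans lo); rewrite leq_pmul2l // ltnn.
exists xi => //.
have := card_imset_collisions (f xi) D.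
have -> : f xi @: D = sumset X (dil xi X).
  apply/setP=> t; apply/imsetP/imset2P => [[[x y] /setXP[xX yX] ->]|].
    by exists x (xi * y); rewrite ?mem_dil.
  by case=> x _ xX /imsetP[y yX ->] ->; exists (x, y); rewrite // inE xX.
move=> h; rewrite -cardD -(@leq_pmul2r #|D|) ?cardD ?expn_gt0 ?X0 // -cardD.
rewrite mulnn mulnAC mulnC; apply: leq_trans h _; rewrite leq_mul //.
Qed.

(** * Characteristic 2, products and the subfield case *)

(** Here [0] and [1] form a subfield, and distinct [x], [y] in [A] put [x + x] and [x + y] into one
    affine image of it; the hypothesis would give [2 ^ 2 <= 2]. *)
Lemma card_le1_char2 (F : finFieldType) (A : {set F}) :
  2%:R = 0 :> F ->
  (forall (G : {set F}) (a b : F), is_subfield G -> a != 0 ->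
     (#|sumset A A :&: affine_image a b G| ^ 2 <= #|G|)%N) ->
  (#|A| <= 1)%N.
Proof.
move=> two0 hG; rewrite leqNgt; apply/negP => /card_gt1P[x [y [xA yA xy]]].
pose G : {set F} := [set 0; 1].
have add11 : 1 + 1 = 0 :> F by rewrite -two0.
have opp1 : - 1 = 1 :> F by apply/esym/eqP; rewrite -subr_eq0 opprK add11.
have fG : is_subfield G.
  split; first by rewrite !inE eqxx orbT.
    by move=> u v; rewrite !inE => /orP[]/eqP-> /orP[]/eqP->;
       rewrite ?subrr ?subr0 ?sub0r ?opp1 ?eqxx ?orbT.
  by move=> u v; rewrite !inE => /orP[]/eqP-> /orP[]/eqP->;
     rewrite ?mul0r ?invr0 ?mulr0 ?divr1 ?eqxx ?orbT.
have yx0 : y - x != 0 by rewrite subr_eq0 eq_sym.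
pose E : {set F} := [set x + x; x + y]; pose L := affine_image (y - x) (x + x) G.
have : (#|E| <= #|sumset A A :&: L|)%N.
  apply: subset_leq_card; apply/subsetP=> t; rewrite !inE => /orP[]/eqP ->.
    rewrite mem_sumset //=; apply/imsetP; exists 0; first by rewrite !inE eqxx.
    by rewrite mulr0 add0r.
  rewrite mem_sumset //=; apply/imsetP; exists 1; first by rewrite !inE eqxx orbT.
  by ring.
have -> : #|E| = 2%N.
  by rewrite cards2; case: eqP => // /addrI /eqP; rewrite (negbTE xy).
have : (#|G| <= 2)%N by rewrite cards2; case: (_ != _).
have := hG G (y - x) (x + x) fG yx0; rewrite -/L; nia.
Qed.

(** This is the triangle inequality through [r A], as [- r A + r s A] is the dilate of [A - s A] by
    [- r]. *)
Lemma card_sumset_mul (F : finFieldType) (A : {set F}) (r s : F) : r != 0 ->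
  (#|sumset A (dil (r * s) A)| * #|A|
     <= #|sumset A (dil r A)| * #|sumset A (dil (- s) A)|)%N.
Proof.
move=> r0; rewrite -(card_dil A r0); apply: leq_trans (ruzsa_triangle _ _ _) _.
rewrite leq_mul // -(@card_dil _ (- r) (sumset A (dil (- s) A))) ?oppr_eq0 //.
by rewrite dil_sumset !dilM mulN1r mulrNN.
Qed.

(** For fixed [x != y] in [X], every [z] in [X] has [(z - x) / (y - x)] in [quot X], so [X] lies in
    [(y - x) quot X + x]. *)
Lemma card_sub_quot_subfield (F : finFieldType) (S X : {set F}) :
  (1 < #|X|)%N -> X \subset S -> is_subfield (quot X) ->
  (forall (G : {set F}) (a b : F), is_subfield G -> a != 0 ->
     (#|S :&: affine_image a b G| ^ 2 <= #|G|)%N) ->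
  (#|X| ^ 2 <= #|quot X|)%N.
Proof.
case/card_gt1P=> x [y [xX yX xy]] XS fX hG.
have yx0 : y - x != 0 by rewrite subr_eq0 eq_sym.
apply: leq_trans (hG _ _ x fX yx0); rewrite leq_exp2r // subset_leq_card //.
apply/subsetP=> z zX; rewrite inE (subsetP XS) //=; apply/imsetP.
exists ((z - x) / (y - x)); last by rewrite mulrCA divff // mulr1 subrK.
by apply/quotP; exists z, x, y, x; split => //; split; rewrite // eq_sym.
Qed.

(** * The bound for [#|A|] in terms of its growth *)

Lemma card_le_growth (R : realFieldType) (F : finFieldType) (A : {set F}) (M : nat) :
  (0 < #|A|)%N ->
  (#|sumset A A| <= M)%N -> (#|sumset (square_set A) (square_set A)| <= M)%N ->
  (forall (G : {set F}) (a b : F), is_subfield G -> a != 0 ->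
     (#|sumset A A :&: affine_image a b G| ^ 2 <= #|G|)%N) ->
  (#|A|%:R : R) <= 2%:R ^+ 27 * (M%:R / #|A|%:R) ^+ 32.
Proof.
move=> A0 hS hB hG; set N : R := #|A|%:R; set K := M%:R / N.
have N0 : 0 < N by rewrite ltr0n.
have AM : (#|A| <= M)%N.
  by have /card_gt0P[a aA] := A0; apply: leq_trans hS; apply: leq_card_sumset aA.
have K1 : 1 <= K by rewrite ler_pdivlMr // mul1r ler_nat.
have K32 : 1 <= K ^+ 32 by rewrite exprn_ege1.
(* As [K >= 1], sets of size at most [2 ^ 27] satisfy the claim at once. *)
have small n : (#|A| <= n)%N -> n%:R <= 2%:R ^+ 27 :> R -> N <= 2%:R ^+ 27 * K ^+ 32.
  move=> An n27; apply: (@le_trans _ _ n%:R); first by rewrite ler_nat.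
  by apply: le_trans n27 _; rewrite ler_peMr ?exprn_ge0.
have [two0|two0] := eqVneq (2%:R : F) 0.
  by apply: (small 1%N); [apply: card_le1_char2 two0 hG | rewrite exprn_ege1 ?ler1n].
have [b bA hb] := popular_sums A0.
set X0 := [set a in A | _] in hb; set X := sumset X0 [set b].
have cX : (#|A| <= 2 * #|X|)%N by rewrite card_translate.
have XA : X \subset sumset A [set b].
  by apply: sumsetS => //; apply/subsetP=> x; rewrite inE => /andP[].
have XS : X \subset sumset A A.
  by apply: subset_trans XA _; apply: sumsetS => //; rewrite sub1set.
have popX x : x \in X -> (#|A| ^ 2 <= 2 * #|sumset A A| * #|rep A x|)%N.
  by case/imset2P=> a _ aX0 /set1P-> ->; move: aX0; rewrite inE => /andP[].
have [X1|X1] := leqP #|X| 1.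
  apply: (small 2%N); first by apply: leq_trans cX _; rewrite (leq_mul2l 2 _ 1).
  by rewrite -{1}[2%:R]expr1 ler_eXn2l // ltr1n.
set Q : R := 8%:R * K ^+ 4.
have Q1 : 1 <= Q by rewrite mulr_ege1 ?ler1n ?exprn_ege1.
have ratio cs ds u v : v != 0 -> v = \sum_(c <- cs) c -> u = \sum_(c <- ds) c ->
    (forall c, c \in cs ++ ds -> exists2 s, c = s \/ c = - s & s \in X) ->
    #|sumset A (dil (u / v) A)|%:R <= Q ^+ size (cs ++ ds) * N.
  move=> v0 ev eu csX; apply: le_trans (_ : #|dilsum A (cs ++ ds)|%:R <= _).
    by rewrite ler_nat card_sumset_ratio.
  apply: card_dilsum_popular => // c /csX[s hs sX]; exists s => //; exact: popX.
have quot4 r : r \in quot X -> #|sumset A (dil r A)|%:R <= Q ^+ 4 * N.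
  case/quotP=> x [y [z [t [xX yX zX tX [zt ->]]]]].
  apply: (ratio [:: z; - t] [:: x; - y]); rewrite ?subr_eq0 //.
  - by rewrite big_cons big_seq1.
  - by rewrite big_cons big_seq1.
  - move=> c; rewrite !inE => /or4P[]/eqP->;
      [exists z|exists t|exists x|exists y]; by [|left|right].
have [xi hxi bxi] : exists2 xi, (#|X| ^ 2 <= 2 * #|sumset X (dil xi X)|)%N &
    #|sumset A (dil xi A)|%:R <= Q ^+ 8 * N.
  have notin xi : xi \notin quot X -> (#|X| ^ 2 <= 2 * #|sumset X (dil xi X)|)%N.
    by move=> h; rewrite card_sumset_notin_quot // leq_pmull.
  have [/forall_inP mulX|] := boolP [forall r in quot X, forall s in quot X, r * s \in quot X];
    last first.
    rewrite negb_forall_in => /exists_inP[r rX].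
    rewrite negb_forall_in => /exists_inP[s sX rsX]; exists (r * s); first exact: notin.
    have r0 : r != 0 by apply: contraNneq rsX => ->; rewrite mul0r quot0.
    (* The bounds [Q ^ 4 N] for [r] and [- s] multiply, and one factor [N] cancels. *)
    rewrite -(ler_pM2r N0) -natrM.
    apply: le_trans (_ : (#|sumset A (dil r A)| * #|sumset A (dil (- s) A)|)%:R <= _).
      by rewrite ler_nat card_sumset_mul.
    have -> : Q ^+ 8 * N * N = (Q ^+ 4 * N) * (Q ^+ 4 * N) by ring.
    by rewrite natrM ler_pM // quot4 // quotN.
  have [/forall_inP addX|] := boolP [forall r in quot X, r + 1 \in quot X]; last first.
    rewrite negb_forall_in => /exists_inP[r rX r1X]; exists (r + 1); first exact: notin.
    have [x [y [z [t [xX yX zX tX [zt er]]]]]] := quotP _ _ rX.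
    have zt0 : z - t != 0 by rewrite subr_eq0.
    (* The common denominator [z - t] makes six dilates enough. *)
    have -> : r + 1 = (x - y + z - t) / (z - t) by rewrite er; field.
    apply: le_trans (_ : Q ^+ 6 * N <= _); last first.
      by rewrite ler_pM2r // ler_weXn2l.
    apply: (ratio [:: z; - t] [:: x; - y; z; - t]) => //.
    - by rewrite big_cons big_seq1.
    - by rewrite !big_cons big_nil; ring.
    - move=> c; rewrite !inE.
      case/orP=> [/eqP->|]; first by exists z; [left|].
      case/orP=> [/eqP->|]; first by exists t; [right|].
      by case/or4P=> /eqP->; [exists x|exists y|exists z|exists t]; by [|left|right].
  have fX : is_subfield (quot X).
    by apply: quot_subfield => // r s rX sX; apply: (forall_inP (mulX r rX)).
  have [xi xiX hxi] := exists_large_dilate (ltnW X1) (card_sub_quot_subfield X1 XS fX hG).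
  exists xi => //; apply: le_trans (quot4 _ xiX) _.
  by rewrite ler_pM2r // ler_weXn2l.
have leXA : (#|sumset X (dil xi X)| <= #|sumset A (dil xi A)|)%N.
  rewrite -(card_translate (sumset A _) (b + xi * b)); apply: subset_leq_card.
  apply/subsetP=> _ /imset2P[_ _ /(subsetP XA)/imset2P[x _ xA /set1P-> ->]
    /imsetP[_ /(subsetP XA)/imset2P[y _ yA /set1P-> ->] ->] ->].
  have -> : x + b + xi * (y + b) = (x + xi * y) + (b + xi * b) by ring.
  by rewrite !(mem_sumset, mem_dil) ?set11.
(* The chain is [N ^ 2 <= 4 #|X| ^ 2 <= 8 #|X + xi X| <= 8 Q ^ 8 N], with [8 * 8 ^ 8 = 2 ^ 27]. *)
have -> : 2%:R ^+ 27 * K ^+ 32 = 8%:R * Q ^+ 8 by rewrite /Q; ring.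
rewrite -(ler_pM2r N0) -mulrA -natrM.
apply: le_trans (_ : 8%:R * #|sumset A (dil xi A)|%:R <= _); last by rewrite ler_pM2l ?ltr0n.
rewrite -natrM ler_nat.
apply: leq_trans (_ : 8 * #|sumset X (dil xi X)| <= _)%N; last by rewrite leq_mul2l leXA orbT.
apply: leq_trans (_ : 4 * #|X| ^ 2 <= _)%N; last by move: hxi; lia.
by apply: leq_trans (leq_mul cX cX) _; rewrite mulnACA mulnn.
Qed.

(** * Passage to the exponent [1 + 1 / 42] *)

Theorem theorem1p2 (R : realType) :
  exists C : R, 0 < C /\
  forall (F : finFieldType) (A : {set F}),
    (forall (G : {set F}) (a b : F), is_subfield G -> a != 0 ->
       #|sumset A A :&: affine_image a b G|%:R <= Num.sqrt (#|G|%:R : R)) ->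
    C * powR #|A|%:R (1 + 1 / 42%:R)
      <= (maxn #|sumset A A| #|sumset (square_set A) (square_set A)|)%:R.
Proof.
pose D : R := 2%:R ^+ 27.
have D1 : 1 <= D by rewrite exprn_ege1 ?ler1n.
have D0 : 0 < D by apply: lt_le_trans D1.
exists D^-1; split; first by rewrite invr_gt0.
move=> F A hG; set M := maxn _ _.
rewrite ler_pdivrMl //; have [->|A0] := posnP #|A|.
  by rewrite powR0 ?mulr_ge0 ?(ltW D0) //; apply: lt0r_neq0; lra.
have N0 : 0 < #|A|%:R :> R by rewrite ltr0n.
have hG' (G : {set F}) (a b : F) : is_subfield G -> a != 0 ->
    (#|sumset A A :&: affine_image a b G| ^ 2 <= #|G|)%N.
  move=> fG a0; have := hG G a b fG a0.
  by rewrite -(ler_pXn2r (isT : 0 < 2)%N) ?nnegrE ?sqrtr_ge0 // sqr_sqrtr // -natrX ler_nat.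
have grow := card_le_growth R A0 (leq_maxl _ _) (leq_maxr _ _) hG'.
rewrite -/M -/D in grow; set K := M%:R / _ in grow.
have K1 : 1 <= K.
  rewrite ler_pdivlMr // mul1r ler_nat /M leq_max; apply/orP; left.
  by have /card_gt0P[a aA] := A0; apply: leq_card_sumset aA.
have K0 : 0 <= K by apply: le_trans K1.
rewrite powRD; last by rewrite (gt_eqF N0) implybT.
rewrite powRr1 ?(ltW N0) // -ler_pdivlMl // (_ : _ * (D * _) = D * K); last first.
  by rewrite mulrCA (mulrC _^-1).
have DK0 : 0 <= D * K by rewrite mulr_ge0 // ltW.
(* What remains is that the root of order 42 of [#|A|] is at most [D K]. As [D] and [K] are at least
   [1], this follows from [#|A| <= D K ^ 32 <= (D K) ^ 42]. *)
have -> : D * K = powR ((D * K) ^+ 42) (1 / 42%:R).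
  by rewrite -powR_mulrn // -powRrM mul1r divff ?pnatr_eq0 // powRr1.
rewrite ge0_ler_powR ?nnegrE ?exprn_ge0 ?divr_ge0 //.
apply: le_trans grow _; rewrite (exprMn 42 D K) ler_pM ?exprn_ge0 ?(ltW D0) //.
  by rewrite -{1}[D]expr1 ler_weXn2l.
by rewrite ler_weXn2l.
Qed.
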